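(* Let $q\in(1/3,1/2)$. Then the set $N_q$ is the attractor of an iterated function system on $\mathbb{R}$ consisting of (finitely many) affine functions with three different ratios; that is, there is a finite family of affine contractions $x\mapsto r_ix+s_i$ of $\mathbb{R}$ whose attractor is $N_q$ and for which the set of ratios $\{r_i\}$ consists of three different numbers.
   Context: $\mathbb{N}=\{1,2,3,\dots\}$. For $q\in(0,1/2)$, sets $U_n^q$ ($n\ge1$) are defined by the usual Cantor construction: start with the interval $[0,1]$; at the $n$-th step there are $2^{n-1}$ disjoint closed intervals of length $q^{n-1}$, and from each of them one removes the concentric open middle interval of length $q^{n-1}(1-2q)$, leaving $2^n$ closed intervals of length $q^n$. $U_n^q$ denotes the union of the $2^{n-1}$ open intervals removed at the $n$-th step. Put $N_q=[0,1]\setminus\bigcup_{n\in\mathbb{N}}U_{2n}^q$. An iterated function system (IFS) on a complete metric space $X$ is a finite sequence $\mathcal{S}=(f_1,\dots,f_m)$ of functions $f_i:X\to X$ with Lipschitz constants strictly smaller than $1$. Its attractor is the unique nonempty compact set $D_0\subset X$ with $D_0=f_1(D_0)\cup\dots\cup f_m(D_0)$. The ratio of an affine function $x\mapsto rx+s$ is the number $r$. *)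

(* Defs.v *)
From mathcomp Require Import all_boot all_order all_algebra.
From mathcomp Require Import all_classical all_reals all_analysis.

Set Implicit Arguments.
Unset Strict Implicit.
Unset Printing Implicit Defensive.

Import Order.TTheory GRing.Theory Num.Theory.
Import numFieldNormedType.Exports.

Local Open Scope classical_set_scope.
Local Open Scope ring_scope.

(* A pair (a, b) stands for the interval with endpoints a and b.  The result is
   the pair of endpoints of the interval concentric with J of length
   q^n (1 - 2 q), where q^n is the length of J. *)
Definition cantor_middle (R : realType) (q : R) (n : nat) (J : R * R) : R * R :=
  let c := (J.1 + J.2) / 2 in
  let l := q ^+ n * (1 - 2 * q) in
  (c - l / 2, c + l / 2).

(* The 2^n closed intervals of length q^n left after n steps. *)
Fixpoint cantor_intervals (R : realType) (q : R) (n : nat) : seq (R * R) :=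
  if n is m.+1 then
    flatten [seq [:: (J.1, (cantor_middle q m J).1);
                     ((cantor_middle q m J).2, J.2)]
            | J <- cantor_intervals q m]
  else [:: (0, 1)].

(* The set U_n^q for n >= 1: step n acts on the intervals left after n - 1
   steps.  The value at n = 0 is meaningless. *)
Definition cantor_removed (R : realType) (q : R) (n : nat) : set R :=
  \bigcup_(J in [set` cantor_intervals q n.-1])
    `](cantor_middle q n.-1 J).1, (cantor_middle q n.-1 J).2[%classic.

Definition Nset (R : realType) (q : R) : set R :=
  `[0, 1]%classic `\`
    \bigcup_(n in [set n | (0 < n)%N]) cantor_removed q (2 * n)%N.

Definition is_ifs (R : realType) (X : completeNormedModType R) (m : nat)
    (f : 'I_m -> X -> X) : Prop :=
  forall i, exists2 k : R, 0 <= k < 1 & k.-lipschitz (f i).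

Definition ifs_invariant (R : realType) (X : completeNormedModType R) (m : nat)
    (f : 'I_m -> X -> X) (D : set X) : Prop :=
  [/\ D !=set0, compact D & D = \bigcup_i (f i @` D)].

Definition is_attractor (R : realType) (X : completeNormedModType R) (m : nat)
    (f : 'I_m -> X -> X) (D : set X) : Prop :=
  ifs_invariant f D /\ forall D', ifs_invariant f D' -> D' = D.

(* Main.v *)
Require Import Defs.
From mathcomp Require Import all_boot all_order all_algebra.
From mathcomp Require Import all_classical all_reals all_analysis.
From mathcomp Require Import finmap ring lra.
Import Order.TTheory GRing.Theory Num.Theory.
Import numFieldNormedType.Exports.
Local Open Scope classical_set_scope.
Local Open Scope ring_scope.

(* N consists of four copies of itself of ratio q^2 and of the interval
   [q, 1 - q], so it is enough to cover this interval by finitely many affine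
   copies of N contained in N.  Let p = q^(2k) be small.  Immediately to the
   left of q the set looks like q - q^2 N, which is invariant under scaling
   about q by p; the copy p N + (q - p q) is therefore contained in N, and it
   contains [q, q + p (1 - 2q)].  A symmetric copy serves the endpoint 1 - q.  What
   remains is a compact subinterval of (q, 1 - q), which is covered by copies of
   the smaller ratio p (1 - 2q) that stay inside [q, 1 - q], each containing an
   interval because N does. *)

(** * Self-similarity of the removed sets *)

Definition itv_affine {R : realType} (r s : R) (J : R * R) : R * R :=
  (r * J.1 + s, r * J.2 + s).

Lemma cantor_middle_affine (R : realType) (q s : R) n J :
  cantor_middle q n.+1 (itv_affine q s J) =
  itv_affine q s (cantor_middle q n J).
Proof. by rewrite /cantor_middle /itv_affine /= exprS; congr pair; field. Qed.

(** The definition subdivides at the last step, whereas self-similarity needs the first step split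
    off. The induction works because forming the gap commutes with affine maps of ratio [q]. *)
Lemma cantor_intervalsS (R : realType) (q : R) n :
  cantor_intervals q n.+1 =
  map (itv_affine q 0) (cantor_intervals q n) ++
  map (itv_affine q (1 - q)) (cantor_intervals q n).
Proof.
elim: n => [|n IHn].
  rewrite /= /cantor_middle /itv_affine /= expr0.
  by do !congr cons; congr pair; field.
rewrite -[LHS]/(flatten (map _ (cantor_intervals q n.+1))) [X in map _ X]IHn.
rewrite map_cat flatten_cat -!map_comp.
congr cat; rewrite [RHS]map_flatten -map_comp; congr flatten;
  by apply: eq_map => J; rewrite /comp !cantor_middle_affine.
Qed.

Lemma cantor_removed1 (R : realType) (q : R) :
  cantor_removed q 1 = `]q, 1 - q[%classic.
Proof.
rewrite /cantor_removed /= set_cons1 bigcup_set1 /cantor_middle /= expr0.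
by apply/seteqP; split=> x /=; rewrite !in_itv /=; lra.
Qed.

Lemma cantor_removedP (R : realType) (q : R) n x :
  cantor_removed q n.+1 x <->
  exists2 J, J \in cantor_intervals q n &
    (cantor_middle q n J).1 < x < (cantor_middle q n J).2.
Proof. by split=> -[J hJ hx]; exists J => //; move: hx; rewrite set_itvE. Qed.

Lemma cantor_removedS (R : realType) (q : R) n : 0 < q ->
  cantor_removed q n.+2 =
  (fun x => q * x) @` cantor_removed q n.+1 `|`
  (fun x => q * x + (1 - q)) @` cantor_removed q n.+1.
Proof.
move=> q0; apply/seteqP; split=> x.
- move=> /cantor_removedP[J]; rewrite cantor_intervalsS mem_cat.
  move=> /orP[] /mapP[K HK ->]; rewrite cantor_middle_affine => /andP[h1 h2].
    left; exists (x / q); last by field; lra.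
    apply/cantor_removedP; exists K => //.
    by rewrite ltr_pdivlMr // ltr_pdivrMr //; move: h1 h2 => /=; lra.
  right; exists ((x - (1 - q)) / q); last by field; lra.
  apply/cantor_removedP; exists K => //.
  by rewrite ltr_pdivlMr // ltr_pdivrMr //; move: h1 h2 => /=; lra.
- case=> -[y /cantor_removedP[K HK h] <-]; apply/cantor_removedP.
    exists (itv_affine q 0 K); first by rewrite cantor_intervalsS mem_cat map_f.
    by rewrite cantor_middle_affine -[q * y]addr0 !ltrD2r !ltr_pM2l.
  exists (itv_affine q (1 - q) K).
    by rewrite cantor_intervalsS mem_cat map_f ?orbT.
  by rewrite cantor_middle_affine !ltrD2r !ltr_pM2l.
Qed.

Lemma cantor_removed_itv01 {R : realType} {q : R} {n} : 0 < q < 1 / 2 ->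
  cantor_removed q n.+1 `<=` `]0, 1[%classic.
Proof.
move=> /andP[q0 q1]; elim: n => [|n IHn].
  by rewrite cantor_removed1 => x /=; rewrite !in_itv /=; lra.
rewrite cantor_removedS // => x [] [y /IHn]; rewrite /= !in_itv /= => hy <-;
  nra.
Qed.

(* Avoiding the removals of a fixed parity: odd steps if [b] is false, even
   steps if [b] is true, since the step is [n.+1]. *)
Definition parity_set {R : realType} (q : R) (b : bool) : set R :=
  [set x | 0 <= x <= 1 /\ forall n, odd n = b -> ~ cantor_removed q n.+1 x].

Lemma Nset_parity (R : realType) (q : R) : Nset q = parity_set q true.
Proof.
apply/seteqP; split=> x -[].
  rewrite set_itvE => /= h01 hU; split=> // n hn hx; apply: hU.
  exists n./2.+1 => //=; suff -> : (2 * n./2.+1)%N = n.+1 by [].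
  by rewrite mul2n doubleS -[in RHS](odd_double_half n) hn.
move=> h01 hU; split; first by rewrite set_itvE.
case=> -[//|n] _; rewrite mulnS => hx; apply: (hU (2 * n).+1) => //=.
by rewrite oddM.
Qed.

(** * How contractions of ratio [q] act on the parity sets *)

Section SelfSimilarity.
Context {R : realType} {q : R}.
Hypothesis hq : 0 < q < 1 / 2.

(** Scaling by [q] turns each removal step into the next one, so the parity flips. The first gap and
    the right-hand copies of later gaps lie beyond [q] and cannot meet the image. *)
Lemma parity_setMl {b y} : 0 <= y <= 1 ->
  parity_set q b (q * y) <-> parity_set q (~~ b) y.
Proof.
case/andP: hq => q0 q1 hy; split=> -[_ hU]; split => //.
- move=> n hn hx; apply: (hU n.+1) => /=; first by rewrite hn negbK.
  by rewrite cantor_removedS //; left; exists y.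
- by nra.
- case=> [_|n /= hn]; first by rewrite cantor_removed1 /= in_itv /=; nra.
  rewrite cantor_removedS // => -[] [z hz].
    move=> /(mulfI (lt0r_neq0 q0)) ezy; apply: (hU n); last by rewrite -ezy.
    by rewrite -hn negbK.
  by have := cantor_removed_itv01 hq _ hz; rewrite /= in_itv /=; nra.
Qed.

Lemma parity_setMr {b y} : 0 <= y <= 1 ->
  parity_set q b (q * y + (1 - q)) <-> parity_set q (~~ b) y.
Proof.
case/andP: hq => q0 q1 hy; split=> -[_ hU]; split => //.
- move=> n hn hx; apply: (hU n.+1) => /=; first by rewrite hn negbK.
  by rewrite cantor_removedS //; right; exists y.
- by nra.
- case=> [_|n /= hn]; first by rewrite cantor_removed1 /= in_itv /=; nra.
  rewrite cantor_removedS // => -[] [z hz].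
    by have := cantor_removed_itv01 hq _ hz; rewrite /= in_itv /=; nra.
  move=> /addIr /(mulfI (lt0r_neq0 q0)) ezy.
  apply: (hU n); last by rewrite -ezy.
  by rewrite -hn negbK.
Qed.

(** The first step has the wrong parity, and all later steps remove points only from [(0, q)] and
    [(1 - q, 1)]. *)
Lemma parity_set_middle x : q <= x <= 1 - q -> parity_set q true x.
Proof.
case/andP: hq => q0 q1 hx; split; first lra.
case=> // n _; rewrite cantor_removedS // => -[] [y hy];
  by have := cantor_removed_itv01 hq _ hy; rewrite /= in_itv /=; nra.
Qed.

Lemma parity_setM_exp {b} k {y} :
  parity_set q b y -> parity_set q b (q ^+ (2 * k) * y).
Proof.
case/andP: (hq) => q0 q1.
move=> hy; elim: k => [|k IHk]; first by rewrite muln0 expr0 mul1r.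
have [h01 _] := IHk; rewrite mulnS exprD -mulrA expr2 -mulrA.
by apply/parity_setMl; [nra|apply/parity_setMl; rewrite ?negbK].
Qed.

(** Scaling about 1 by [q ^+ 2] is the right-hand contraction of ratio [q] applied twice, which
    restores the parity. *)
Lemma parity_set_flipM_exp {b} k {y} :
  parity_set q b y -> parity_set q b (1 - q ^+ (2 * k) * (1 - y)).
Proof.
case/andP: (hq) => q0 q1.
move=> hy; elim: k => [|k IHk]; first by rewrite muln0 expr0 mul1r subKr.
have [h01 _] := IHk.
have -> : 1 - q ^+ (2 * k.+1) * (1 - y) =
    q * (q * (1 - q ^+ (2 * k) * (1 - y)) + (1 - q)) + (1 - q).
  by rewrite mulnS exprD expr2; ring.
by apply/parity_setMr; [nra|apply/parity_setMr; rewrite ?negbK].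
Qed.

(* Left of [q] the set looks like [q - q ^+ 2 * N], which is invariant under
   scaling about [q] by powers of [q ^+ 2]; right of [q] it fills an
   interval. *)
Lemma Nset_scale_left k y : q ^+ (2 * k) <= 1 - 2 * q -> Nset q y ->
  Nset q (q ^+ (2 * k) * y + (q - q ^+ (2 * k) * q)).
Proof.
rewrite Nset_parity; case/andP: (hq) => q0 q1; set p := q ^+ _ => hp hy.
have [/andP[y0 y1] _] := hy; have p0 : 0 < p by rewrite exprn_gt0.
(* For [q <= y] the image lies between [q] and [q + p], hence in the middle interval by [hp]. *)
have [qy|yq] := leP q y; first by apply: parity_set_middle; nra.
(* In the coordinate [y / q], scaling about [q] becomes scaling about 1. *)
have ey : y = q * (y / q) by field; lra.
have h01 : 0 <= y / q <= 1 by rewrite divr_ge0 ?ler_pdivrMr //=; lra.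
have /(parity_setMl h01) hz : parity_set q true (q * (y / q)).
  by rewrite -ey.
have hw := parity_set_flipM_exp k hz.
have -> : p * y + (q - p * q) = q * (1 - p * (1 - y / q)) by field; lra.
by apply/parity_setMl => //; case: hw.
Qed.

Lemma Nset_scale_right k y : q ^+ (2 * k) <= 1 - 2 * q -> Nset q y ->
  Nset q (q ^+ (2 * k) * y + (1 - q - q ^+ (2 * k) * (1 - q))).
Proof.
rewrite Nset_parity; case/andP: (hq) => q0 q1; set p := q ^+ _ => hp hy.
have [/andP[y0 y1] _] := hy; have p0 : 0 < p by rewrite exprn_gt0.
have [qy|yq] := leP y (1 - q); first by apply: parity_set_middle; nra.
have ey : y = q * ((y - (1 - q)) / q) + (1 - q) by field; lra.
have h01 : 0 <= (y - (1 - q)) / q <= 1.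
  by rewrite divr_ge0 ?ler_pdivrMr //=; lra.
have /(parity_setMr h01) hz :
  parity_set q true (q * ((y - (1 - q)) / q) + (1 - q)) by rewrite -ey.
have hw := parity_setM_exp k hz.
have -> : p * y + (1 - q - p * (1 - q)) =
    q * (p * ((y - (1 - q)) / q)) + (1 - q).
  by field; lra.
by apply/parity_setMr => //; case: hw.
Qed.

End SelfSimilarity.

(** * Compactness, and uniqueness of invariant compact sets *)

Lemma Nset_compact (R : realType) (q : R) : compact (Nset q).
Proof.
rewrite /Nset setDE; apply: compact_closedI; first exact: segment_compact.
apply: open_closedC; apply: bigcup_open => n _; apply: bigcup_open => J _.
exact: interval_open.
Qed.

(* By invariance every point of [D] is the image of another point of [D] under
   some [f i], so distances to [D'] within [D] shrink by the factor [k]. *)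
Lemma ifs_invariant_sub (R : realType) (X : completeNormedModType R) (m : nat)
    (f : 'I_m -> X -> X) (D D' : set X) :
  is_ifs f -> ifs_invariant f D -> ifs_invariant f D' -> D `<=` D'.
Proof.
move=> hf [_ cD eD] [[z0 Dz0] cD' eD'].
have [k /andP[k0 k1] hk] : exists2 k : R, 0 <= k < 1 &
    forall i x y, `|f i x - f i y| <= k * `|x - y|.
  have [g hg] := choice (fun i => let: ex_intro2 k a b := hf i in
     ex_intro (fun k => 0 <= k < 1 /\ k.-lipschitz (f i)) k (conj a b)).
  (* The initial value 0 keeps the maximum nonnegative even for an empty family. *)
  exists (\big[Order.max/0]_i g i).
    apply/andP; split; first by apply: bigmax_ge_id.
    by apply/bigmax_ltP; split=> // i _; case: (hg i) => /andP[].
  move=> i x y; have [_ /(_ (x, y) (conj I I)) /= h] := hg i.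
  by apply: le_trans h _; rewrite ler_wpM2r ?le_bigmax.
have [N [_ hN]] := compact_bounded cD.
(* Norms on [D] are bounded by every number above [N], such as [N + 1]; so [M] bounds the distance
   from [z0] to points of [D]. *)
pose M := N + 1 + `|z0|.
have near n x : D x -> exists2 y, D' y & `|x - y| <= k ^+ n * M.
  elim: n x => [|n IHn] x Dx.
    exists z0 => //; rewrite expr0 mul1r (le_trans (ler_normB _ _)) // lerD2r.
    by apply: hN => //; rewrite ltrDl.
  move: Dx; rewrite eD => -[i _ [x' Dx' <-]].
  have [y' Dy' hy'] := IHn _ Dx'.
  exists (f i y'); first by rewrite eD'; exists i => //; exists y'.
  by rewrite exprS -mulrA (le_trans (hk _ _ _)) // ler_wpM2l.
move=> x Dx; apply: (compact_closed _ cD'); first exact: norm_hausdorff.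
move=> B /nbhs_ballP[e /= e0 hB].
have : k ^+ n * M @[n --> \oo] --> 0 * M.
  by apply: cvgM; [apply: cvg_expr; rewrite ger0_norm|exact: cvg_cst].
move=> /cvgrPdist_lt /(_ e e0)[n _ /(_ n (leqnn n))] /= hn.
have [y Dy hy] := near n _ Dx; exists y; split=> //; apply: hB.
rewrite -ball_normE /=; apply: le_lt_trans hy _.
by apply: le_lt_trans hn; rewrite mul0r sub0r normrN ler_norm.
Qed.

(** * The affine maps and their covering property *)

Section CoveringMaps.
Context {R : realType} {q : R} (k : nat).
Hypotheses (hq : 0 < q < 1 / 2) (k2 : (1 < k)%N)
  (hk : q ^+ (2 * k) <= 1 - 2 * q).

Let p : R := q ^+ (2 * k).
Let p' : R := p * (1 - 2 * q).

(* The number of consecutive intervals of length [p' * (1 - 2 * q)] needed to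
   cover the interval from [q + p'] to [1 - q - p']. *)
Definition middle_copies : nat := (Num.truncn ((1 - 2 * p) / p')).+1.

(* Pairs (ratio, shift).  The first four maps cover what lies outside
   [(q, 1 - q)], the next two cover neighbourhoods of [q] and of [1 - q] in
   [[q, 1 - q]], and the others have images inside [[q, 1 - q]]. *)
Definition covering_maps : seq (R * R) :=
  [:: (q ^+ 2, 0); (q ^+ 2, q - q ^+ 2); (q ^+ 2, 1 - q); (q ^+ 2, 1 - q ^+ 2);
      (p, q - p * q); (p, 1 - q - p * (1 - q))] ++
  [seq (p', q + p' + j%:R * (p' * (1 - 2 * q)) - p' * q)
     | j <- iota 0 middle_copies].

(** Strictness will make the three ratios distinct; [k2] gives the last inequality. *)
Lemma ratio_bounds : [/\ 0 < p', p' < p & p < q ^+ 2].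
Proof.
case/andP: hq => q0 q1.
have p0 : 0 < p by rewrite exprn_gt0.
rewrite /p'; split.
- by rewrite mulr_gt0 //; lra.
- by rewrite gtr_pMr //; lra.
- have h2 : (2 * 1 < 2 * k)%N by rewrite ltn_pmul2l.
  by rewrite /p ltr_iXn2l //; lra.
Qed.

Lemma covering_ratios : [seq c.1 | c <- covering_maps] =i [:: q ^+ 2; p; p'].
Proof.
move=> x; rewrite map_cat mem_cat -map_comp.
rewrite [X in _ || X](_ : _ = (x == p')).
  by rewrite !inE; case: (x == q ^+ 2) => //; case: (x == p).
by apply/mapP/eqP => [[j _ ->] //|->]; exists 0%N.
Qed.

Lemma covering_maps_sub c y :
  c \in covering_maps -> Nset q y -> Nset q (c.1 * y + c.2).
Proof.
case/andP: (hq) => q0 q1; have [p'0 p'p pq] := ratio_bounds.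
rewrite mem_cat => /orP[|/mapP[j hj ->] hy]; last first.
  have h01 : 0 <= y <= 1 by move: hy; rewrite Nset_parity => -[].
  rewrite Nset_parity; apply: parity_set_middle => //=.
  have hpq : p' * q <= p' by rewrite ler_piMr; lra.
  have hpy : 0 <= p' * y <= p' by rewrite mulr_ge0 ?ler_piMr; lra.
  (* The right-hand side equals [1 - 2 * q - 2 * p'], the length of [[q + p', 1 - q - p']]; hence
     even the last copy ends before [1 - q]. *)
  have : j%:R * (p' * (1 - 2 * q)) <= (1 - 2 * p) * (1 - 2 * q).
    rewrite mulrA ler_pM2r ?subr_gt0; last lra.
    rewrite -ler_pdivlMr //.
    have /truncn_itv/andP[h _] : 0 <= (1 - 2 * p) / p'.
      by rewrite divr_ge0 //; nra.
    apply: le_trans h; rewrite ler_nat.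
    by move: hj; rewrite mem_iota add0n ltnS.
  have : 0 <= j%:R * (p' * (1 - 2 * q)).
    by rewrite mulr_ge0 // mulr_ge0; lra.
  by rewrite /p' in hpq hpy *; nra.
rewrite !inE => hc hy; move: hc.
(* The double negation lets two successive contractions match syntactically. *)
have hy' : parity_set q (~~ ~~ true) y by rewrite -Nset_parity.
have h01 := hy'.1.
have /(parity_setMl hq h01) hl := hy'.
have /(parity_setMr hq h01) hr := hy'.
have hl1 := hl.1; have hr1 := hr.1.
have hll := (parity_setMl hq hl1).2 hl.
have hlr := (parity_setMr hq hl1).2 hl.
have hrl := (parity_setMl hq hr1).2 hr.
have hrr := (parity_setMr hq hr1).2 hr.
case/or4P=> [/eqP->|/eqP->|/eqP->|/or3P[]/eqP->] /=.
- rewrite Nset_parity; move: hll; congr (parity_set _ _ _); ring.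
- rewrite Nset_parity; move: hrl; congr (parity_set _ _ _); ring.
- rewrite Nset_parity; move: hlr; congr (parity_set _ _ _); ring.
- rewrite Nset_parity; move: hrr; congr (parity_set _ _ _); ring.
- exact: Nset_scale_left.
- exact: Nset_scale_right.
Qed.

(** Such a [y] avoids the first gap, so it lies in one of the two outer intervals, and pulling it
    back flips the parity. Combined with one more pull-back, this yields the four copies of ratio
    [q ^+ 2]. *)
Lemma parity_set_false_cover y : parity_set q false y ->
  exists2 z, Nset q z & y = q * z \/ y = q * z + (1 - q).
Proof.
case/andP: (hq) => q0 q1 hy; rewrite Nset_parity.
have [h01 /(_ 0%N erefl)] := hy.
rewrite cantor_removed1 set_itvE /= => /negP.
rewrite negb_and -!leNgt => /orP[] h.
  have ey : y = q * (y / q) by field; lra.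
  exists (y / q); last by left.
  apply/(@parity_setMl _ _ hq false); last by rewrite -ey.
  by rewrite divr_ge0 ?ler_pdivrMr //=; lra.
have ey : y = q * ((y - (1 - q)) / q) + (1 - q) by field; lra.
exists ((y - (1 - q)) / q); last by right.
apply/(@parity_setMr _ _ hq false); last by rewrite -ey.
by rewrite divr_ge0 ?ler_pdivrMr //=; lra.
Qed.

Lemma covering_maps_cover x : Nset q x ->
  exists2 c, c \in covering_maps & exists2 y, Nset q y & c.1 * y + c.2 = x.
Proof.
case/andP: (hq) => q0 q1; have [p'0 p'p pq] := ratio_bounds.
have p0 : 0 < p := lt_trans p'0 p'p.
move=> hx; have [h01 _] : parity_set q true x by rewrite -Nset_parity.
have [xq|qx] := ltP x q.
  have ex : x = q * (x / q) by field; lra.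
  have : parity_set q false (x / q).
    apply/(@parity_setMl _ _ hq true); last by rewrite -ex -Nset_parity.
    by rewrite divr_ge0 ?ler_pdivrMr //=; lra.
  case/parity_set_false_cover=> z hz ez.
  have [e|e] : x = q * (q * z) \/ x = q * (q * z + (1 - q)).
    by case: ez => ez; [left|right]; rewrite -ez.
  - exists (q ^+ 2, 0); first by rewrite !inE eqxx.
    by exists z => //=; rewrite e; ring.
  - exists (q ^+ 2, q - q ^+ 2); first by rewrite !inE eqxx ?orbT.
    by exists z => //=; rewrite e; ring.
have [xq|qx'] := ltP (1 - q) x.
  have ex : x = q * ((x - (1 - q)) / q) + (1 - q) by field; lra.
  have : parity_set q false ((x - (1 - q)) / q).
    apply/(@parity_setMr _ _ hq true); last by rewrite -ex -Nset_parity.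
    by rewrite divr_ge0 ?ler_pdivrMr //=; lra.
  case/parity_set_false_cover=> z hz ez.
  have [e|e] : x = q * (q * z) + (1 - q) \/ x = q * (q * z + (1 - q)) + (1 - q).
    by case: ez => ez; [left|right]; rewrite -ez.
  - exists (q ^+ 2, 1 - q); first by rewrite !inE eqxx ?orbT.
    by exists z => //=; rewrite e; ring.
  - exists (q ^+ 2, 1 - q ^+ 2); first by rewrite !inE eqxx ?orbT.
    by exists z => //=; rewrite e; ring.
have inN y : q <= y <= 1 - q -> Nset q y.
  by rewrite Nset_parity; apply: parity_set_middle.
(* The map of ratio [p] fixing [q] sends [[q, 1 - q]] onto [[q, q + p']]. *)
have [xl|lx] := leP x (q + p').
  exists (p, q - p * q); first by rewrite !inE eqxx ?orbT.
  exists (q + (x - q) / p); last by rewrite /=; field; lra.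
  apply: inN; rewrite lerDl divr_ge0 ?subr_ge0 //=; last by lra.
  by rewrite -lerBrDl ler_pdivrMr //; rewrite /p' in xl; lra.
have [xr|rx] := leP (1 - q - p') x.
  exists (p, 1 - q - p * (1 - q)); first by rewrite !inE eqxx ?orbT.
  exists (1 - q - (1 - q - x) / p); last by rewrite /=; field; lra.
  apply: inN; rewrite gerBl divr_ge0 ?subr_ge0 //=; last by lra.
  rewrite andbT lerBrDr -lerBrDl ler_pdivrMr //; rewrite /p' in xr; lra.
(* Maps of ratio [p'] send [[q, 1 - q]] to intervals of length [w], laid end to end from [q + p'];
   the integer part of [t] selects the one containing [x]. *)
pose w := p' * (1 - 2 * q); have w0 : 0 < w by rewrite mulr_gt0 //; lra.
pose t := (x - (q + p')) / w.
have t0 : 0 <= t by rewrite divr_ge0; lra.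
have /andP[jt tj] := truncn_itv t0; set j := Num.truncn t in jt tj.
have xt : x = q + p' + t * w by rewrite /t; field; lra.
exists (p', q + p' + j%:R * w - p' * q).
  rewrite mem_cat; apply/orP; right; apply/mapP; exists j => //.
  rewrite mem_iota add0n ltnS /= le_truncn //.
  rewrite /t ler_pdivrMr // /w mulrA divfK ?gt_eqF //; rewrite /p' in rx *; lra.
exists (q + (x - (q + p' + j%:R * w)) / p'); last by rewrite /=; field; lra.
have u0 : j%:R * w <= t * w by rewrite ler_pM2r.
have u1 : t * w <= (j%:R + 1) * w by rewrite ler_pM2r // natr1 ltW.
apply: inN; rewrite lerDl divr_ge0 ?(ltW p'0) //=; last by lra.
by rewrite -lerBrDl ler_pdivrMr // (_ : _ * p' = w); [lra|rewrite /w; ring].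
Qed.

End CoveringMaps.

(** * Choice of [k], counting of the ratios, and conclusion *)

Lemma card_eq_seq (T : choiceType) (s : seq T) :
  uniq s -> ([set` s] #= `I_(size s))%card.
Proof.
move=> us; have -> : [set` s] = [set` [fset x in s]%fset].
  by apply/seteqP; split=> x /=; rewrite in_fset.
by apply/card_eq_fsetP; rewrite card_fseq undup_id.
Qed.

Lemma expr_eventually_le (R : realType) (a e : R) : 0 < a < 1 -> 0 < e ->
  exists2 k, (1 < k)%N & a ^+ k <= e.
Proof.
move=> /andP[a0 a1] e0.
have : a ^+ n @[n --> \oo] --> (0 : R) by apply: cvg_expr; rewrite gtr0_norm.
move=> /cvgrPdist_le /(_ e e0)[n _ hn]; exists (maxn 2 n).
  by rewrite leq_max leqnn.
have := hn (maxn 2 n) (leq_maxr _ _).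
by rewrite /= sub0r normrN; apply: le_trans; rewrite ler_norm.
Qed.

Lemma is_ifs_affine (R : realType) (m : nat) (r s : 'I_m -> R) :
  (forall i, `|r i| < 1) -> @is_ifs R R m (fun i x => r i * x + s i).
Proof.
move=> hr i; exists `|r i|; first by rewrite normr_ge0 hr.
move=> [x y] _ /=; suff -> : r i * x + s i - (r i * y + s i) = r i * (x - y).
  by rewrite normrM.
by ring.
Qed.

Theorem theorem13 (R : realType) (q : R) (hq : 1 / 3 < q < 1 / 2) :
  exists (m : nat) (r s : 'I_m -> R),
    let f := fun (i : 'I_m) (x : R) => r i * x + s i in
    [/\ is_ifs f, is_attractor f (Nset q) & (range r #= `I_3)%card].
Proof.
have hq' : 0 < q < 1 / 2 by lra.
have hq2 : 0 < q ^+ 2 < 1 by nra.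
have [k k2 hk] : exists2 k, (1 < k)%N & q ^+ (2 * k) <= 1 - 2 * q.
  have [|k k2] := expr_eventually_le _ _ (1 - 2 * q) hq2; first lra.
  by exists k => //; rewrite exprM.
have [p'0 p'p pq] := ratio_bounds k hq' k2.
pose maps := covering_maps (q := q) k.
pose c (i : 'I_(size maps)) := nth (0, 0) maps i.
have mapsP d : d \in maps <-> exists i, c i = d.
  split=> [/(nthP (0, 0))[i hi <-]|[i <-]]; last exact: mem_nth.
  by exists (Ordinal hi).
have hratio := covering_ratios (q := q) k.
exists (size maps), (fun i => (c i).1), (fun i => (c i).2) => f.
have ifs_f : is_ifs f.
  apply: is_ifs_affine => i.
  have : (c i).1 \in [seq d.1 | d <- maps] by rewrite map_f // mem_nth.
  by rewrite hratio !inE => /or3P[] /eqP ->; rewrite gtr0_norm; lra.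
have inv_N : ifs_invariant f (Nset q).
  split; [|exact: Nset_compact|].
    by exists q; rewrite Nset_parity; apply: parity_set_middle => //; lra.
  apply/seteqP; split=> x.
    move=> /(covering_maps_cover k hq' k2 _)[d /mapsP[i <-] [y hy <-]].
    by exists i => //; exists y.
  move=> [i _ [y hy <-]].
  by apply: (covering_maps_sub k hq' k2 hk) => //; apply/mapsP; exists i.
split=> //.
- split=> // D hD; apply/seteqP.
  by split; apply: (ifs_invariant_sub _ _ _ f).
- have -> : range (fun i => (c i).1) = [set` [seq d.1 | d <- maps]].
    apply/seteqP; split=> x; first by move=> [i _ <-]; exact/map_f/mem_nth.
    by move=> /mapP[d /mapsP[i <-] ->]; exists i.
  have -> : [set` [seq d.1 | d <- maps]] =
      [set` [:: q ^+ 2; q ^+ (2 * k); q ^+ (2 * k) * (1 - 2 * q)]].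
    by apply/seteqP; split=> x; rewrite /mkset hratio.
  apply: card_eq_seq; rewrite /= !inE !negb_or !andbT.
  by rewrite !gt_eqF //; lra.
Qed.
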